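(* Let $f:\mathbb{R}^D\to\mathbb{R}$ be continuously differentiable, attaining its global minimum $f^*=\min_{\boldsymbol{x}\in\mathbb{R}^D}f(\boldsymbol{x})$, with effective dimensionality $d_e$ and effective subspace $\mathcal{T}$ spanned by the columns of an orthonormal matrix $\boldsymbol{U}\in\mathbb{R}^{D\times d_e}$. Let $\boldsymbol{p}\in\mathbb{R}^D$. Then the reduced problem $\min_{\boldsymbol{y}\in\mathbb{R}^{d}}f(\boldsymbol{A}\boldsymbol{y}+\boldsymbol{p})$ with $\boldsymbol{A}=\boldsymbol{U}$ (and $d=d_e$) is successful, i.e. there exists $\boldsymbol{y}\in\mathbb{R}^{d_e}$ such that $f(\boldsymbol{U}\boldsymbol{y}+\boldsymbol{p})=f^*$.
   Context: A function $f:\mathbb{R}^D\to\mathbb{R}$ has effective dimensionality $d_e\le D$ if (i) there exists a linear subspace $\mathcal{T}\subset\mathbb{R}^D$ of dimension $d_e$ such that $f(\boldsymbol{x}_\top+\boldsymbol{x}_\perp)=f(\boldsymbol{x}_\top)$ for all $\boldsymbol{x}_\top\in\mathcal{T}$ and all $\boldsymbol{x}_\perp\in\mathcal{T}^\perp$, and (ii) $d_e$ is the smallest integer with this property. Such a $\mathcal{T}$ is called the effective subspace of $f$. An orthonormal matrix here is one with orthonormal columns. *)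

(* Defs.v *)
From HB Require Import structures.
From mathcomp Require Import all_boot all_order all_algebra.
From mathcomp Require Import all_classical all_reals all_analysis.
Set Implicit Arguments.
Unset Strict Implicit.
Unset Printing Implicit Defensive.
Import Order.TTheory GRing.Theory Num.Theory.
Import numFieldNormedType.Exports.
Local Open Scope classical_set_scope.
Local Open Scope ring_scope.

Definition gradient (R : realType) (D : nat) (f : 'cV[R]_D -> R)
    (x : 'cV[R]_D) : 'cV[R]_D :=
  \col_i 'D_(delta_mx i 0) f x.

(* 'cV[R]_D carries the sup norm; in finite dimension this gives the same
   differentiability and continuity as the Euclidean norm. *)
Definition continuously_differentiable (R : realType) (D : nat)
    (f : 'cV[R]_D -> R) : Prop :=
  (forall x, differentiable f x) /\ continuous (gradient f).

Definition global_minimum (R : realType) (D : nat) (f : 'cV[R]_D -> R)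
    (m : R) : Prop :=
  (exists x, f x = m) /\ (forall x, m <= f x).

Definition dotv (R : realType) (D : nat) (u v : 'cV[R]_D) : R :=
  \sum_(i < D) u i 0 * v i 0.

Definition orthogonal_complement (R : realType) (D : nat)
    (T : {vspace 'cV[R]_D}) : set 'cV[R]_D :=
  [set x | forall t, t \in T -> dotv x t = 0].

Definition determined_on (R : realType) (D : nat) (f : 'cV[R]_D -> R)
    (T : {vspace 'cV[R]_D}) : Prop :=
  forall xt xp : 'cV[R]_D, xt \in T -> orthogonal_complement T xp ->
    f (xt + xp) = f xt.

Definition effective_dimensionality (R : realType) (D : nat)
    (f : 'cV[R]_D -> R) (de : nat) : Prop :=
  (exists T : {vspace 'cV[R]_D}, \dim T = de /\ determined_on f T) /\
  (forall d : nat,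
     (exists T : {vspace 'cV[R]_D}, \dim T = d /\ determined_on f T) ->
     (de <= d)%N).

Definition effective_subspace (R : realType) (D : nat)
    (f : 'cV[R]_D -> R) (T : {vspace 'cV[R]_D}) : Prop :=
  effective_dimensionality f (\dim T) /\ determined_on f T.

Definition orthonormal_columns (R : realType) (D d : nat)
    (U : 'M[R]_(D, d)) : Prop :=
  U^T *m U = 1%:M.

Definition column_span (R : realType) (D d : nat) (U : 'M[R]_(D, d)) :
    {vspace 'cV[R]_D} :=
  <<[seq col j U | j : 'I_d]>>%VS.

(* fstar is meant to be the global minimum of f on the whole space. *)
Definition reduced_problem_successful (R : realType) (D d : nat)
    (f : 'cV[R]_D -> R) (fstar : R) (A : 'M[R]_(D, d)) (p : 'cV[R]_D) : Prop :=
  exists y : 'cV[R]_d, f (A *m y + p) = fstar.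

(* Main.v *)
(* Write P = U U^T for the orthogonal projection onto T.  Since x - P x lies in
   the orthogonal complement of T, f x depends only on P x.  If x* is a
   minimizer and y = U^T (x* - p), then P (U y + p) = P x*. *)
Require Import Defs.
From HB Require Import structures.
From mathcomp Require Import all_boot all_order all_algebra.
From mathcomp Require Import all_classical all_reals all_analysis.
Import Order.TTheory GRing.Theory Num.Theory.
Import numFieldNormedType.Exports.
Local Open Scope ring_scope.

(** Used to place the projection [U *m (U^T *m x)] in the subspace: the entries of [y] serve as
    coefficients on the columns. *)
Lemma mulmx_column_span (R : realType) (D d : nat) (U : 'M[R]_(D, d))
    (y : 'cV[R]_d) : U *m y \in column_span U.
Proof.
have -> : U *m y = \sum_j y j 0 *: col j U.
  apply/colP => i; rewrite mxE summxE; apply: eq_bigr => j _.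
  by rewrite !mxE mulrC.
apply: memv_suml => j _; apply: memvZ; apply: memv_span; apply/fintype.imageP.
by exists j.
Qed.

Lemma dotvE (R : realType) (D : nat) (u v : 'cV[R]_D) :
  dotv u v = (u^T *m v) 0 0.
Proof. by rewrite mxE; apply: eq_bigr => i _; rewrite mxE. Qed.

Lemma column_span_orthogonal (R : realType) (D d : nat) (U : 'M[R]_(D, d))
    (x : 'cV[R]_D) :
  U^T *m x = 0 -> orthogonal_complement (column_span U) x.
Proof.
move=> Ux0 t tU; have xU0 : x^T *m U = 0.
  by apply: trmx_inj; rewrite trmx_mul trmxK Ux0 trmx0.
(* The vectors orthogonal to [x] form the kernel of a linear map, so it suffices to test the
   generators of the span, that is, the columns of [U]. *)
suff /subvP/(_ t tU) : (column_span U <= lker (linfun (mulmx x^T)))%VS.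
  by rewrite memv_ker lfunE /= dotvE => /eqP ->; rewrite mxE.
apply/span_subvP => _ /fintype.imageP[j _ ->].
by rewrite memv_ker lfunE /= colE mulmxA xU0 mul0mx.
Qed.

Lemma determined_on_proj (R : realType) (D d : nat) (f : 'cV[R]_D -> R)
    (U : 'M[R]_(D, d)) (x : 'cV[R]_D) :
  determined_on f (column_span U) -> orthonormal_columns U ->
  f x = f (U *m (U^T *m x)).
Proof.
(* Adding the residual [x - U *m (U^T *m x)] leaves the right-hand value unchanged and rebuilds [x];
   its orthogonality follows from [U^T *m U = 1%:M]. *)
move=> fU UU; rewrite -(fU (U *m _) (x - U *m (U^T *m x))) ?mulmx_column_span //.
  by rewrite addrC subrK.
apply: column_span_orthogonal.
by rewrite mulmxBr (mulmxA U^T) UU mul1mx subrr.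
Qed.

Theorem lemma2p8 (R : realType) (D de : nat) (f : 'cV[R]_D -> R) (fstar : R)
    (T : {vspace 'cV[R]_D}) (U : 'M[R]_(D, de)) (p : 'cV[R]_D)
    (hC1 : continuously_differentiable f)
    (hmin : global_minimum f fstar)
    (hde : effective_dimensionality f de)
    (hT : effective_subspace f T)
    (hU : orthonormal_columns U)
    (hspan : T = column_span U) :
  reduced_problem_successful f fstar U p.
Proof.
have [[x <-] _] := hmin; have [_] := hT; rewrite hspan => fU.
exists (U^T *m (x - p)).
rewrite (determined_on_proj _ _ _ _ _ _ fU hU) mulmxDr (mulmxA U^T) hU mul1mx.
(* Both sides now have the same coordinates in [U], since [U^T *m (x - p) + U^T *m p = U^T *m x];
   the projection is then undone at [x]. *)
by rewrite -mulmxDr subrK -determined_on_proj.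
Qed.
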